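(* Let $\Delta$ be an alcove, $\nu\in\Delta$, and set $\mu_j=e^{2\pi i\tau\nu_j}$ for $j=1,\dots,N$. Let $I\in\mathcal I_\lambda$ and let $h,z,t$ be fixed. As $q=e^{2\pi i\tau}\to0$, $$W^{\mathrm{ell}}_I(t,z,h,\mu)\ \to\ c(h)\,h^{-\ell_I/2}\,X(t)^{-1/2}\,W^\Delta_I(t,z,h),$$ where $c(h)=(-1)^{\sum_{k=1}^{N-1}\lambda^{(k)}\lambda^{(k+1)}}h^{-\sum_{k=1}^{N-1}(\lambda^{(k)})^2/2}$ and $$X(t)=\prod_{k=1}^{N-1}\prod_{a=1}^{\lambda^{(k)}}\prod_{b=1}^{\lambda^{(k+1)}}\big(t^{(k+1)}_b/t^{(k)}_a\big)=\prod_{k=1}^{N-1}\prod_{a=1}^{\lambda^{(k)}}(t^{(k)}_a)^{-\lambda_k-\lambda_{k+1}}\prod_{a=1}^nz_a^{n-\lambda_N}.$$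
   Context: Fix positive integers $n,N$ and $\lambda=(\lambda_1,\dots,\lambda_N)\in\mathbb Z_{\ge0}^N$ with $\sum_k\lambda_k=n$. Put $\lambda^{(k)}=\lambda_1+\dots+\lambda_k$, $\lambda^{\{1\}}=\lambda^{(1)}+\dots+\lambda^{(N-1)}$. $\mathcal I_\lambda$ is the set of ordered partitions $I=(I_1,\dots,I_N)$ of $\{1,\dots,n\}$ with $|I_k|=\lambda_k$; write $\bigcup_{j\le k}I_j=\{i^{(k)}_1<\dots<i^{(k)}_{\lambda^{(k)}}\}$. Let $p_{I,j}(m)=|I_j\cap\{1,\dots,m-1\}|$ and let $j(I,k,a)$ be the index $j$ with $i^{(k)}_a\in I_j$. Put $$\ell_I=\#\{(a,b)\in\{1,\dots,n\}^2: a\in I_j,\ b\in I_k,\ a>b,\ j<k\}.$$ Theta function: $\operatorname{Im}\tau>0$, $q=e^{2\pi i\tau}$; for $x=e^{2\pi iu}$, $x^{1/2}=e^{\pi iu}$, $\vartheta(x)=(x^{1/2}-x^{-1/2})\phi(qx)\phi(q/x)$ with $\phi(x)=\prod_{s\ge0}(1-q^sx)$. Fractional powers are determined by fixed logarithms of $h,z_a,t^{(k)}_a$ (and $\log\mu_j=2\pi i\tau\nu_j$, $\log q=2\pi i\tau$); $q\to0$ means $\operatorname{Im}\tau\to+\infty$. Variables: $t=(t^{(k)}_a)$, $1\le k\le N-1$, $1\le a\le\lambda^{(k)}$; $z=(z_1,\dots,z_n)$ with $t^{(N)}_a=z_a$; $h$; $\mu=(\mu_1,\dots,\mu_N)$.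 $\operatorname{Sym}_{t^{(k)}}$ is the sum over all permutations of $t^{(k)}_1,\dots,t^{(k)}_{\lambda^{(k)}}$. Elliptic weight function: $$W^{\mathrm{ell}}_I=\vartheta(h)^{\lambda^{\{1\}}}\operatorname{Sym}_{t^{(1)}}\cdots\operatorname{Sym}_{t^{(N-1)}}\prod_{k=1}^{N-1}\prod_{a=1}^{\lambda^{(k)}}\Big(\prod_{c=1}^{\lambda^{(k+1)}}\psi^{\mathrm{ell}}_{I,k,a,c}(t^{(k+1)}_c/t^{(k)}_a)\prod_{b=a+1}^{\lambda^{(k)}}\frac{\vartheta(ht^{(k)}_b/t^{(k)}_a)}{\vartheta(t^{(k)}_b/t^{(k)}_a)}\Big),$$ where $\psi^{\mathrm{ell}}_{I,k,a,c}(x)$ equals $\vartheta(hx)$ if $i^{(k+1)}_c<i^{(k)}_a$; $\vartheta(x)$ if $i^{(k+1)}_c>i^{(k)}_a$; and $\vartheta(x\,h^{1+p_{I,j}(i^{(k)}_a)-p_{I,k+1}(i^{(k)}_a)}\mu_{k+1}/\mu_j)\big/\vartheta(h^{1+p_{I,j}(i^{(k)}_a)-p_{I,k+1}(i^{(k)}_a)}\mu_{k+1}/\mu_j)$ with $j=j(I,k,a)$ if $i^{(k+1)}_c=i^{(k)}_a$. Alcoves are the connected components of the complement in $\mathbb R^N$ of all hyperplanes $\nu_j-\nu_i=m$, $1\le i<j\le N$, $m\in\mathbb Z$; the integer characteristics of $\Delta$ are $m_{i,j}=\lfloor\nu_j-\nu_i\rfloor$ ($i<j$), $\nu\in\Delta$.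 Trigonometric weight function: $$W^\Delta_I=(1-h)^{\lambda^{\{1\}}}\operatorname{Sym}_{t^{(1)}}\cdots\operatorname{Sym}_{t^{(N-1)}}\prod_{k=1}^{N-1}\prod_{a=1}^{\lambda^{(k)}}\Big(\prod_{c=1}^{\lambda^{(k+1)}}\psi^\Delta_{I,k,a,c}(t^{(k+1)}_c/t^{(k)}_a)\prod_{b=a+1}^{\lambda^{(k)}}\frac{1-ht^{(k)}_b/t^{(k)}_a}{1-t^{(k)}_b/t^{(k)}_a}\Big),$$ where $\psi^\Delta_{I,k,a,c}(x)$ equals $1-hx$ if $i^{(k+1)}_c<i^{(k)}_a$, equals $x^{-m_{j,k+1}}$ with $j=j(I,k,a)$ if $i^{(k+1)}_c=i^{(k)}_a$, and equals $1-x$ if $i^{(k+1)}_c>i^{(k)}_a$. *)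

(* Defs.v *)
From HB Require Import structures.
From mathcomp Require Import all_boot all_order all_algebra all_fingroup.
From mathcomp Require Import all_classical all_reals all_analysis.
From mathcomp Require Import complex.

Set Implicit Arguments.
Unset Strict Implicit.
Unset Printing Implicit Defensive.

Import Order.TTheory GRing.Theory Num.Theory numFieldNormedType.Exports.

(* Indexing.  The blocks I_1, ..., I_N, the parts lambda_1, ..., lambda_N and  *)
(* the elements of {1, ..., n} are numbered from 0, through 'I_N and 'I_n.     *)
(* The levels k of the variables t^(k) keep their usual numbering 1, ..., N,   *)
(* so for 1 <= k < N the block "I_(k+1)" (and mu_(k+1), lambda_(k+1)) is the   *)
(* one of index k, and I_1, ..., I_k are the blocks of index < k.              *)

Section Combinatorics.
Local Open Scope nat_scope.
Context {n N : nat}.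
Implicit Type lam : N.-tuple nat.

(* lambda^(k) *)
Definition psum lam (k : nat) : nat := \sum_(j < N | j < k) tnth lam j.

(* The set I_lambda; blocks may be empty. *)
Record opart lam := OPart {
  block :> 'I_N -> {set 'I_n};
  opart_disjoint : forall j k : 'I_N, j != k -> [disjoint block j & block k];
  opart_cover : forall m : 'I_n, exists j, m \in block j;
  opart_card : forall k : 'I_N, #|block k| = tnth lam k }.

Context {lam : N.-tuple nat}.
Implicit Type I : opart lam.

Definition union_blocks I (k : nat) : {set 'I_n} :=
  (\bigcup_(j < N | j < k) I j)%SET.

Lemma card_union_blocks I k : psum lam k = #|union_blocks I k|.
Proof.
have -> : union_blocks I k =
    (\bigcup_(j : 'I_N) (if j < k then I j else finset.set0))%SET.
  by rewrite /union_blocks big_mkcond.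
rewrite -sum1_card partition_disjoint_bigcup /=; last first.
  move=> i j ij; rewrite -finset.setI_eq0.
  do 2![case: ifP => _]; rewrite ?finset.setI0 ?finset.set0I//.
  by rewrite finset.setI_eq0 opart_disjoint.
rewrite /psum big_mkcond; apply: eq_bigr => j _; rewrite sum1_card.
by case: ifP; rewrite ?cards0 ?opart_card.
Qed.

(* i^(k)_a: [enum_val] lists the elements of a set of ordinals increasingly.   *)
Definition elt I (k : nat) (a : 'I_(psum lam k)) : 'I_n :=
  enum_val (cast_ord (card_union_blocks I k) a).

(* The index j such that m \in I_j. *)
Definition block_of I (m : 'I_n) : 'I_N := xchoose (opart_cover I m).

Definition pI I (j : 'I_N) (m : 'I_n) : nat := #|[set x in I j | x < m]%SET|.

Definition ellI I : nat :=
  #|[set ab : 'I_n * 'I_n | (ab.2 < ab.1) &&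
       [exists j : 'I_N, exists k : 'I_N,
          [&& ab.1 \in I j, ab.2 \in I k & j < k]]]%SET|.

(* A family t = (t^(k)_a) of variables.  Only the levels 1 <= k <= N are used: *)
(* level 0 is empty, and level N holds the variables z_a.                      *)
Definition vars (lam : N.-tuple nat) (T : Type) : Type :=
  forall k : nat, 'I_(psum lam k) -> T.

Definition SymAt (T : Type) (V : nmodType) (k : nat) (F : vars lam T -> V) :
    vars lam T -> V :=
  fun t => (\sum_(s : 'S_(psum lam k)) F (dfwith t k (t k \o s)))%R.

(* Sym_{t^(1)} ... Sym_{t^(N-1)} *)
Definition Sym (T : Type) (V : nmodType) (F : vars lam T -> V) :
    vars lam T -> V :=
  foldr (fun k G => SymAt k G) F (iota 1 N.-1).

Definition lambda_one (lam : N.-tuple nat) : nat :=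
  \sum_(k < N | 0 < k) psum lam k.

End Combinatorics.

Arguments opart n {N} lam.

Local Open Scope classical_set_scope.
Local Open Scope ring_scope.

Section Theta.
Context {R : realType}.
Local Notation C := R[i].

Definition cexp (z : C) : C :=
  ((expR (complex.Re z))%:C * (cos (complex.Im z) +i* sin (complex.Im z)))%C.

Definition twopii : C := (0 +i* (2 * pi))%C.

Definition phi (q x : C) : C :=
  lim (((fun m : nat => \prod_(s < m) (1 - q ^+ s * x)) : nat -> C^o) @ \oo).

(* [theta tau l] is vartheta(x) for x = cexp l.  The argument is the logarithm *)
(* l = 2 pi i u of x, which determines x^(1/2) = cexp (l / 2).                 *)
Definition theta (tau l : C) : C :=
  let q := cexp (twopii * tau) in
  (cexp (l / 2) - cexp (- (l / 2))) * phi q (q * cexp l) * phi q (q / cexp l).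

(* The filter of neighbourhoods of "Im tau --> +oo", with no condition on      *)
(* Re tau; equivalently, of q = exp (2 pi i tau) --> 0.                        *)
Definition q_to_0 : set_system C :=
  [set P : set C | exists M : R, forall tau, M < complex.Im tau -> P tau].

Global Instance q_to_0_filter : ProperFilter q_to_0.
Proof.
split=> [[M M0]|].
  by apply: (M0 (0 +i* (M + 1))%C); rewrite /= ltrDl.
split; first by exists 0.
- move=> P Q [M PM] [M' QM]; exists (Num.max M M') => tau.
  by rewrite gt_max => /andP[? ?]; split; [exact: PM|exact: QM].
- by move=> P Q PQ [M PM]; exists M => tau /PM /PQ.
Qed.

End Theta.

Section Alcoves.
Context {R : realType} {N : nat}.

Definition hyperplanes_compl : set 'rV[R]_N :=
  [set nu | forall (i j : 'I_N) (m : int), (i < j)%N -> nu 0 j - nu 0 i != m%:~R].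

Definition is_alcove (D : set 'rV[R]_N) : Prop :=
  exists2 x, hyperplanes_compl x & D = connected_component hyperplanes_compl x.

(* m_(i,j), for i < j, computed at an arbitrarily chosen point of the alcove. *)
Definition alcove_char (D : set 'rV[R]_N) (i j : 'I_N) : int :=
  let nu := get D in Num.floor (nu 0 j - nu 0 i).

End Alcoves.

Section WeightFunctions.
Context {R : realType} {n N : nat} {lam : N.-tuple nat}.
Local Notation C := R[i].
Implicit Type I : opart n lam.

(* Here [lh], [lmu], [lt] and [lx] are the fixed logarithms of h, mu, t and x. *)

Definition psi_ell I (tau lh : C) (lmu : 'I_N -> C) (k : 'I_N)
    (a : 'I_(psum lam k)) (c : 'I_(psum lam k.+1)) (lx : C) : C :=
  let ia := elt I a in
  let ic := elt I c in
  let j := block_of I ia in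
  let ly := (1 + (pI I j ia)%:R - (pI I k ia)%:R) * lh + lmu k - lmu j in
  if (ic < ia)%N then theta tau (lh + lx)
  else if (ia < ic)%N then theta tau lx
  else theta tau (lx + ly) / theta tau ly.

Definition W_ell I (tau : C) (lt : vars lam C) (lh : C) (lmu : 'I_N -> C) : C :=
  theta tau lh ^+ lambda_one lam *
  Sym (fun lt : vars lam C =>
    \prod_(k < N | (0 < k)%N) \prod_(a < psum lam k)
      ((\prod_(c < psum lam k.+1)
          psi_ell I tau lh lmu a c (lt k.+1 c - lt k a)) *
       \prod_(b < psum lam k | (a < b)%N)
          (theta tau (lh + lt k b - lt k a) / theta tau (lt k b - lt k a)))) lt.

Definition psi_trig I (D : set 'rV[R]_N) (h : C) (k : 'I_N)
    (a : 'I_(psum lam k)) (c : 'I_(psum lam k.+1)) (x : C) : C :=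
  let ia := elt I a in
  let ic := elt I c in
  if (ic < ia)%N then 1 - h * x
  else if (ia < ic)%N then 1 - x
  else x ^ (- alcove_char D (block_of I ia) k).

Definition W_trig I (D : set 'rV[R]_N) (t : vars lam C) (h : C) : C :=
  (1 - h) ^+ lambda_one lam *
  Sym (fun t : vars lam C =>
    \prod_(k < N | (0 < k)%N) \prod_(a < psum lam k)
      ((\prod_(c < psum lam k.+1) psi_trig I D h a c (t k.+1 c / t k a)) *
       \prod_(b < psum lam k | (a < b)%N)
          ((1 - h * (t k b / t k a)) / (1 - t k b / t k a)))) t.

Definition c_coef (lam : N.-tuple nat) (lh : C) : C :=
  (-1) ^+ (\sum_(k < N | (0 < k)%N) psum lam k * psum lam k.+1)%N *
  cexp (- ((\sum_(k < N | (0 < k)%N) psum lam k ^ 2)%N%:R / 2) * lh).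

Definition X (t : vars lam C) : C :=
  \prod_(k < N | (0 < k)%N) \prod_(a < psum lam k) \prod_(b < psum lam k.+1)
    (t k.+1 b / t k a).

(* The logarithm of X determined by those of the variables. *)
Definition logX (lt : vars lam C) : C :=
  \sum_(k < N | (0 < k)%N) \sum_(a < psum lam k) \sum_(b < psum lam k.+1)
    (lt k.+1 b - lt k a).

End WeightFunctions.

(* Main.v *)
Require Import Defs.
From HB Require Import structures.
From mathcomp Require Import all_boot all_order all_algebra all_fingroup.
From mathcomp Require Import all_classical all_reals all_analysis.
From mathcomp Require Import complex.
From mathcomp Require Import zify ring lra.

(* As q -> 0, phi(y) -> 1 whenever y -> 0, so vartheta(x) -> - x^(-1/2) (1 - x)
   at fixed x. At a point q^s y with s not an integer, the quasi-periodicity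
   vartheta(qx) = - q^(-1/2) x^(-1) vartheta(x) first brings s into (0, 1), where
   vartheta(y) ~ - y^(-1/2); hence
   vartheta(q^s y x) / vartheta(q^s y) -> x^(-1/2) x^(-floor s).  Every factor of
   the elliptic integrand thus tends to the matching trigonometric factor times
   a monomial.  The product of these monomials depends on t only through X(t),
   which is symmetric, so it factors out of Sym; its exponent of h is computed
   from l_I = sum_k #{(x, y) : x in I_1 u ... u I_k, y in I_(k+1), y < x}. *)

Set Implicit Arguments.
Unset Strict Implicit.
Unset Printing Implicit Defensive.

Import Order.TTheory GRing.Theory Num.Theory numFieldNormedType.Exports.

Local Open Scope classical_set_scope.
Local Open Scope ring_scope.

(** * Limits in the complex numbers *)

Section ComplexLimits.
Context {R : realType}.
Local Notation C := R[i].

Lemma real_complex_gt0 (e : C) : 0 < e -> exists2 r : R, 0 < r & e = (r%:C)%C.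
Proof.
move=> e0; have /RRe_real eE : e \is Num.real by rewrite gtr0_real.
by exists (complex.Re e) => //; rewrite -ltcR eE.
Qed.

Lemma cvg_re_im (T : Type) (F : set_system T) (FF : Filter F) (f : T -> C)
    (a b : R) :
  complex.Re (f x) @[x --> F] --> a -> complex.Im (f x) @[x --> F] --> b ->
  f x @[x --> F] --> ((a +i* b)%C : C^o).
Proof.
move=> /cvgrPdist_lt fa /cvgrPdist_lt fb; apply/(@cvgrPdist_lt _ C^o) => e.
move=> /real_complex_gt0[r r0 ->]; have r20 : 0 < r / 2 by rewrite divr_gt0.
near=> x.
have ha : `|a - complex.Re (f x)| < r / 2 by near: x; exact: fa.
have hb : `|b - complex.Im (f x)| < r / 2 by near: x; exact: fb.
have -> : (a +i* b)%C - f x = ((a - complex.Re (f x))%:C)%C +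
    'i%C * ((b - complex.Im (f x))%:C)%C :> C.
  by case: (f x) => u v /=; simpc.
apply: (le_lt_trans (ler_normD _ _)); rewrite normrM.
have -> : `|'i%C : C| = 1 by rewrite normc_def /= expr0n/= expr1n add0r sqrtr1.
rewrite mul1r !normc_def /= expr0n /= !addr0 !sqrtr_sqr -rmorphD/= ltcR.
by rewrite [ltRHS]splitr ltrD.
Unshelve. all: by end_near. Qed.

Section ComplexCvg.
Context (T : Type) (F : set_system T) {FF : Filter F}.
Implicit Types (f g : T -> C) (a b : C).

(** Restated at [C^o] to pin the normed-module structure in which limits in [C] are taken. *)
Lemma cvgC_cst a : a @[_ --> F] --> (a : C^o).
Proof. exact: (@cvg_cst C^o). Qed.

Lemma cvgC_sub f g a b : f x @[x --> F] --> (a : C^o) ->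
  g x @[x --> F] --> (b : C^o) -> f x - g x @[x --> F] --> (a - b : C^o).
Proof. exact: (@cvgB C C^o). Qed.

Lemma cvgC_mul f g a b : f x @[x --> F] --> (a : C^o) ->
  g x @[x --> F] --> (b : C^o) -> f x * g x @[x --> F] --> (a * b : C^o).
Proof. exact: (@cvgM C). Qed.

Lemma cvgC_inv f a : a != 0 -> f x @[x --> F] --> (a : C^o) ->
  (f x)^-1 @[x --> F] --> (a^-1 : C^o).
Proof. exact: (@cvgV C). Qed.

Lemma cvgC_add f g a b : f x @[x --> F] --> (a : C^o) ->
  g x @[x --> F] --> (b : C^o) -> f x + g x @[x --> F] --> (a + b : C^o).
Proof. exact: (@cvgD C C^o). Qed.

Lemma cvgC_sum (I : Type) (r : seq I) (P : pred I) (f : I -> T -> C) (a : I -> C) :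
  (forall i, P i -> f i x @[x --> F] --> (a i : C^o)) ->
  \sum_(i <- r | P i) f i x @[x --> F] --> (\sum_(i <- r | P i) a i : C^o).
Proof.
move=> fa; elim: r => [|i r IH].
  by under eq_cvg do rewrite big_nil; rewrite big_nil; exact: cvgC_cst.
under eq_cvg do rewrite big_cons; rewrite big_cons.
case: ifPn => Pi; last exact: IH.
by apply: cvgC_add; [exact: fa|exact: IH].
Qed.

Lemma cvgC_prod (I : Type) (r : seq I) (P : pred I) (f : I -> T -> C) (a : I -> C) :
  (forall i, P i -> f i x @[x --> F] --> (a i : C^o)) ->
  \prod_(i <- r | P i) f i x @[x --> F] --> (\prod_(i <- r | P i) a i : C^o).
Proof.
move=> fa; elim: r => [|i r IH].
  by under eq_cvg do rewrite big_nil; rewrite big_nil; exact: cvgC_cst.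
under eq_cvg do rewrite big_cons; rewrite big_cons.
case: ifPn => Pi; last exact: IH.
by apply: cvgC_mul; [exact: fa|exact: IH].
Qed.

Lemma cvgC_exp f a m : f x @[x --> F] --> (a : C^o) ->
  f x ^+ m @[x --> F] --> (a ^+ m : C^o).
Proof.
move=> fa; elim: m => [|m IH]; first exact: cvgC_cst.
under eq_cvg do rewrite exprS.
by rewrite exprS; apply: cvgC_mul; [exact: fa|exact: IH].
Qed.

End ComplexCvg.

(** The telescoping series of [u] is dominated by a geometric series of ratio 1/2. *)
Lemma cvgn_geometric_step (u : R^nat) (B : R) :
  (forall m, `|u m.+1 - u m| <= B / 2 ^+ m) -> cvgn u.
Proof.
move=> hu; have : cvgn (series (telescope u)).
  apply: normed_cvg; apply: (@series_le_cvg _ _ (geometric B 2^-1)).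
  - by move=> m /=.
  - by move=> m; rewrite /geometric/= exprVn; exact: le_trans (hu m).
  - by move=> m; rewrite /geometric/= exprVn; exact: hu.
  - apply: is_cvg_geometric_series; rewrite ger0_norm ?invr_ge0//.
    by rewrite invf_lt1 ?ltr1n.
rewrite telescopeK; move: (u 0%N) => c /cvg_ex[l hl]; apply/cvg_ex; exists (l + c).
have <- : [sequence u n - c]_n + cst c = u by apply/funext => m; exact: subrK.
by apply: (cvgD hl); exact: cvg_cst.
Qed.

(** [B] bounds a norm, hence is real; the real and imaginary parts of the steps inherit the bound,
    so the real case gives both limits. *)
Lemma cvgn_complex_geometric_step (u : nat -> C) (B : C) :
  (forall m, `|u m.+1 - u m| <= B / 2 ^+ m) -> exists l : C^o, u @ \oo --> l.
Proof.
move=> hu; have h0 (m : nat) : `|u m.+1 - u m| <= ((complex.Re B / 2 ^+ m)%:C)%C.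
  have B0 : 0 <= B by have := hu 0%N; rewrite expr0 divr1; apply: le_trans.
  rewrite (rmorphM (real_complex R)) (fmorphV (real_complex R)).
  rewrite (rmorphXn (real_complex R)) (rmorph_nat (real_complex R) 2) /=.
  by rewrite (RRe_real (ger0_real B0)); exact: hu.
have hre : cvgn (fun m => complex.Re (u m)).
  apply: (@cvgn_geometric_step _ (complex.Re B)) => m.
  rewrite -lecR (le_trans _ (h0 m))// (le_trans _ (normc_ge_Re _))//.
  by case: (u m.+1) (u m) => [a b] [c d].
have him : cvgn (fun m => complex.Im (u m)).
  apply: (@cvgn_geometric_step _ (complex.Re B)) => m.
  rewrite -lecR (le_trans _ (h0 m))//.
  rewrite (_ : complex.Im _ - _ = complex.Im (u m.+1 - u m)); last first.
    by case: (u m.+1) (u m) => [a b] [c d].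
  (* Im y is minus the real part of i y, so the bound on real parts applies here too. *)
  rewrite -normrN -ReiNIm (le_trans (normc_ge_Re _))// normrM.
  rewrite [X in _ * X](_ : _ = 1) ?mulr1//.
  by rewrite normc_def /= expr0n/= expr1n add0r sqrtr1.
by exists (limn (fun m => complex.Re (u m)) +i* limn (fun m => complex.Im (u m)))%C;
  exact: cvg_re_im.
Qed.

Lemma cvgn_dist_le (K : numFieldType) (u : nat -> K) (l a b : K) :
  u @ \oo --> l -> (forall m, `|u m - a| <= b) -> `|l - a| <= b.
Proof.
move=> /cvgrPdist_lt hu hb; apply/ler_addgt0Pr => e e0.
have [m _ /(_ m (leqnn m)) /= hm] := hu _ e0.
rewrite -(subrKA (u m)) addrC (le_trans (ler_normD _ _))// lerD ?hb//.
exact: ltW.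
Qed.

End ComplexLimits.

(** * The theta function as q -> 0 *)

Section Exponential.
Context {R : realType}.
Local Notation C := R[i].
Implicit Types x y : C.

Lemma cexpD x y : cexp (x + y) = cexp x * cexp y.
Proof.
case: x y => [a b] [c d]; rewrite /cexp/= expRD cosD sinD; simpc.
by apply/eqP; rewrite eq_complex/=; apply/andP; split; apply/eqP; ring.
Qed.

Lemma cexp0 : cexp 0 = 1 :> C.
Proof. by rewrite /cexp/= expR0 cos0 sin0; simpc. Qed.

Lemma cexpNK x : cexp x * cexp (- x) = 1.
Proof. by rewrite -cexpD subrr cexp0. Qed.

Lemma cexp_neq0 x : cexp x != 0.
Proof.
by apply: contra_eqN (cexpNK x) => /eqP ->; rewrite mul0r eq_sym oner_neq0.
Qed.

Lemma cexpN x : cexp (- x) = (cexp x)^-1.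
Proof. by apply: (mulfI (cexp_neq0 x)); rewrite cexpNK mulfV ?cexp_neq0. Qed.

Lemma cexpB x y : cexp (x - y) = cexp x / cexp y.
Proof. by rewrite cexpD cexpN. Qed.

Lemma cexp_sum (I : Type) (r : seq I) (P : pred I) (F : I -> C) :
  cexp (\sum_(i <- r | P i) F i) = \prod_(i <- r | P i) cexp (F i).
Proof. by rewrite (big_morph _ cexpD cexp0). Qed.

Lemma cexpMnl x (m : nat) : cexp (m%:R * x) = cexp x ^+ m.
Proof.
by elim: m => [|m IH]; rewrite ?mul0r ?cexp0// -natr1 mulrDl mul1r cexpD IH exprSr.
Qed.

Lemma norm_cexp x : `|cexp x| = ((expR (complex.Re x))%:C)%C.
Proof.
rewrite /cexp normrM !normc_def /= expr0n addr0 sqrtr_sqr cos2Dsin2 sqrtr1 mulr1.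
by rewrite ger0_norm ?expR_ge0.
Qed.

(** The norm is exp (Re w - 2 pi s Im tau), whatever Re tau is. *)
Lemma cexp_q_cvg0 (s : R) (w : C) : 0 < s ->
  cexp (w + twopii * tau * (s%:C)%C) @[tau --> q_to_0] --> (0 : C^o).
Proof.
move=> s0; apply/(@cvgrPdist_lt _ C^o) => e /real_complex_gt0[r r0 ->].
(* The bound on Im tau solves Re w - 2 pi s Im tau < ln r. *)
exists ((complex.Re w - ln r) / (2 * pi * s)) => tau.
rewrite ltr_pdivrMr ?mulr_gt0 ?pi_gt0// => htau.
rewrite /= sub0r normrN norm_cexp ltcR -[ltRHS](lnK r0) ltr_expR.
case: w tau htau => [a b] [c d] /=; simpc => /=; nra.
Qed.

End Exponential.

(** * Convergence of the infinite product phi and its behaviour near 0 *)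

Section Phi.
Context {R : realType}.
Local Notation C := R[i].

Implicit Types q x : C.

Definition phi_part (q x : C) (m : nat) : C := \prod_(s < m) (1 - q ^+ s * x).

Lemma phi_partS q x m : phi_part q x m.+1 = (1 - x) * phi_part q (q * x) m.
Proof.
rewrite /phi_part big_ord_recl expr0 mul1r; congr (_ * _).
by apply: eq_bigr => s _; rewrite exprSr mulrA.
Qed.

(* The bound 2 - c, c = 2^-m, is inductive: (2 - c) (1 + c / 4) <= 2 - c / 2. *)
Lemma phi_part_small q x m : `|q| <= 2^-1 -> `|x| <= 4^-1 ->
  `|phi_part q x m| <= 2 - (2 ^+ m)^-1.
Proof.
move=> hq hx; elim: m => [|m IH].
  by rewrite /phi_part big_ord0 normr1 expr0 invr1 -[2]/(1 + 1) addrK.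
rewrite /phi_part big_ord_recr /= -/(phi_part q x m) normrM.
have h1 : `|1 - q ^+ m * x| <= 1 + 4^-1 * (2 ^+ m)^-1.
  rewrite (le_trans (ler_normB _ _))// normr1 lerD2l normrM normrX mulrC.
  by rewrite ler_pM// -exprVn lerXn2r// ?nnegrE ?invr_ge0.
apply: le_trans (ler_pM _ _ IH h1) _ => //.
set c := (2 ^+ m)^-1; have c0 : 0 <= c by rewrite invr_ge0 exprn_ge0.
rewrite exprS invfM -/c -subr_ge0.
have -> : 2 - 2^-1 * c - (2 - c) * (1 + 4^-1 * c) = c * c / 4 by field.
by rewrite divr_ge0 ?mulr_ge0.
Qed.

(** The step is minus [phi_part q x m] times q^m x; the first factor is bounded by 2 and q^m by
    2^-m. *)
Lemma phi_part_step q x m : `|q| <= 2^-1 -> `|x| <= 4^-1 ->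
  `|phi_part q x m.+1 - phi_part q x m| <= (2 * `|x|) / 2 ^+ m.
Proof.
move=> hq hx; rewrite {1}/phi_part big_ord_recr /= -/(phi_part q x m).
rewrite mulrBr mulr1 addrAC subrr sub0r normrN !normrM -mulrA ler_pM//.
  by rewrite (le_trans (phi_part_small m hq hx))// gerBl invr_ge0 exprn_ge0.
by rewrite mulrC ler_pM// normrX -exprVn lerXn2r// ?nnegrE ?invr_ge0.
Qed.

Lemma phi_part_dist q x m : `|q| <= 2^-1 -> `|x| <= 4^-1 ->
  `|phi_part q x m - 1| <= 4 * `|x|.
Proof.
(* The steps sum to 2|x| (1 + 1/2 + ... + 2^(1-m)) = 4|x| (1 - 2^-m); the induction needs this exact
   form. *)
move=> hq hx; suff : `|phi_part q x m - 1| <= 4 * `|x| * (1 - (2 ^+ m)^-1).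
  by move/le_trans; apply; rewrite ler_piMr ?mulr_ge0// gerBl invr_ge0 exprn_ge0.
elim: m => [|m IH].
  by rewrite /phi_part big_ord0 subrr normr0 expr0 invr1 subrr mulr0.
rewrite -(subrKA (phi_part q x m)) (le_trans (ler_normD _ _))//.
apply: le_trans (lerD (phi_part_step m hq hx) IH) _.
rewrite exprS invfM le_eqVlt; apply/orP; left; apply/eqP.
by field; rewrite expf_neq0.
Qed.

Lemma phi_part_cvg_small q x : `|q| <= 2^-1 -> `|x| <= 4^-1 ->
  exists l : C^o, phi_part q x @ \oo --> l.
Proof.
move=> hq hx; apply: (@cvgn_complex_geometric_step _ _ (2 * `|x|)) => m.
exact: phi_part_step.
Qed.

Lemma phi_part_cvgS q x (l : C^o) : phi_part q (q * x) @ \oo --> l ->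
  phi_part q x @ \oo --> ((1 - x) * l : C^o).
Proof.
move=> hl; rewrite -(@cvg_shiftS C^o) /=.
under eq_cvg do rewrite phi_partS.
apply: cvgC_mul; [exact: cvgC_cst|exact: hl].
Qed.

(** Some q^K x lies in the small disc, where the steps decay geometrically; each return from q x to
    x costs one factor 1 - x. *)
Lemma phi_part_cvg q x : `|q| <= 2^-1 ->
  exists l : C^o, phi_part q x @ \oo --> l.
Proof.
move=> hq; have [K hK] : exists K : nat, `|q| ^+ K * `|x| <= 4^-1.
  (* Any [K] above 4|x| will do, since K < 2^K; the archimedean bound is taken in [R]. *)
  have [K hK] : exists K : nat, 4 * `|x| <= (2 ^+ K : C).
    have xE := RRe_real (normr_real x); set y := complex.Re `|x| in xE.
    have /archi_boundP : 0 <= 4 * y by rewrite mulr_ge0// -ler0c xE.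
    set K := Num.bound _ => hK; exists K.
    have : 4 * y <= 2 ^+ K.
      by apply/ltW/(lt_trans hK); rewrite -natrX ltr_nat ltn_expl.
    rewrite -lecR (rmorphM (real_complex R)) (rmorphXn (real_complex R)) /=.
    by rewrite !(rmorph_nat (real_complex R)) xE.
  exists K; apply: (@le_trans _ _ ((2 ^+ K)^-1 * `|x|)).
    by rewrite ler_wpM2r// -exprVn lerXn2r// ?nnegrE ?invr_ge0.
  by rewrite mulrC ler_pdivrMr ?exprn_gt0// mulrC ler_pdivlMr// mulrC.
elim: K x hK => [|K IH] x hK.
  by apply: phi_part_cvg_small => //; rewrite expr0 mul1r in hK.
have [|l hl] := IH (q * x); first by rewrite normrM mulrA -exprSr.
by exists ((1 - x) * l); exact: phi_part_cvgS.
Qed.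

Lemma phiE q x (l : C^o) : phi_part q x @ \oo --> l -> phi q x = l.
Proof. by apply: (@cvg_lim C^o); exact: norm_hausdorff. Qed.

Lemma phiS q x : `|q| <= 2^-1 -> phi q x = (1 - x) * phi q (q * x).
Proof.
move=> hq; have [l hl] := phi_part_cvg (q * x) hq.
by rewrite (phiE hl) (phiE (phi_part_cvgS hl)).
Qed.

Lemma phi_dist q x : `|q| <= 2^-1 -> `|x| <= 4^-1 -> `|phi q x - 1| <= 4 * `|x|.
Proof.
move=> hq hx; have [l hl] := phi_part_cvg_small hq hx; rewrite (phiE hl).
by apply: (cvgn_dist_le hl) => m; exact: phi_part_dist.
Qed.

(** The estimate [phi_dist] is uniform in q, so q and x may vary together. *)
Lemma phi_cvg1 (T : Type) (F : set_system T) (FF : Filter F) (q x : T -> C) :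
  q s @[s --> F] --> (0 : C^o) -> x s @[s --> F] --> (0 : C^o) ->
  phi (q s) (x s) @[s --> F] --> (1 : C^o).
Proof.
move=> /(@cvgr0_norm_le _ C^o) hq /(@cvgr0_norm_le _ C^o) hx.
apply/(@cvgrPdist_le _ C^o) => e e0.
near=> s.
have hqs : `|q s| <= 2^-1 by near: s; apply: hq; rewrite invr_gt0.
have hxs : `|x s| <= 4^-1 by near: s; apply: hx; rewrite invr_gt0.
rewrite distrC (le_trans (phi_dist hqs hxs))// mulrC -ler_pdivlMr//.
by near: s; apply: hx; rewrite divr_gt0.
Unshelve. all: by end_near. Qed.

End Phi.

(** * Limits of theta and of its quotients *)

Section Theta.
Context {R : realType}.
Local Notation C := R[i].
Implicit Types (tau l x w : C).

(** Theta stripped of - x^(-1/2): a function of x = [cexp l] alone, free of the choice of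
    logarithm. *)
Definition theta_prod tau l : C :=
  let q := cexp (twopii * tau) in
  (1 - cexp l) * phi q (q * cexp l) * phi q (q / cexp l).

Lemma theta_prodE tau l : theta tau l = - cexp (- (l / 2)) * theta_prod tau l.
Proof.
rewrite /theta /theta_prod !mulrA; congr (_ * _ * _).
rewrite mulrBr mulr1 mulNr -cexpD opprK [RHS]addrC; congr (cexp _ - _).
by rewrite [X in _ + X]splitr addKr.
Qed.

Lemma nome_cvg0 : cexp (twopii * tau) @[tau --> q_to_0] --> (0 : C^o).
Proof.
have := @cexp_q_cvg0 R 1 0 ltr01.
by under eq_cvg do rewrite add0r mulr1.
Qed.

Lemma nome_small : \forall tau \near (q_to_0 : set_system C),
  `|cexp (twopii * tau)| <= 2^-1.
Proof.
by move/(@cvgr0_norm_le _ C^o): nome_cvg0; apply; rewrite invr_gt0.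
Qed.

(** Here x may move with tau: its finite limit makes q x vanish, q/x vanishes by hypothesis, so both
    values of [phi] tend to 1. *)
Lemma theta_prod_cvg (l : C -> C) (y : C) :
  cexp (l tau) @[tau --> q_to_0] --> (y : C^o) ->
  cexp (twopii * tau - l tau) @[tau --> q_to_0] --> (0 : C^o) ->
  theta_prod tau (l tau) @[tau --> q_to_0] --> (1 - y : C^o).
Proof.
move=> hl hql; rewrite -(mulr1 (1 - y)) -(mulr1 ((1 - y) * 1)).
apply: cvgC_mul; last first.
  apply: phi_cvg1; first exact: nome_cvg0.
  by under eq_cvg do rewrite -cexpB.
apply: cvgC_mul; first by apply: cvgC_sub; [exact: cvgC_cst|exact: hl].
apply: phi_cvg1; first exact: nome_cvg0.
by rewrite -(mul0r y); apply: cvgC_mul; [exact: nome_cvg0|exact: hl].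
Qed.

Lemma theta_cvg l :
  theta tau l @[tau --> q_to_0] --> (- cexp (- (l / 2)) * (1 - cexp l) : C^o).
Proof.
under eq_cvg do rewrite theta_prodE.
apply: cvgC_mul; first exact: cvgC_cst.
apply: (@theta_prod_cvg (fun=> l)); first exact: cvgC_cst.
have := @cexp_q_cvg0 R 1 (- l) ltr01.
by under eq_cvg do rewrite mulr1 addrC.
Qed.

(** With x = e^w q^s one has q/x = e^(-w) q^(1-s); both vanish since s and 1 - s are positive. *)
Lemma theta_prod_cvg1 w (s : R) : 0 < s < 1 ->
  theta_prod tau (w + twopii * tau * (s%:C)%C) @[tau --> q_to_0] --> (1 : C^o).
Proof.
case/andP=> s0 s1; rewrite -[1 in X in _ --> X]subr0; apply: theta_prod_cvg.
  exact: cexp_q_cvg0.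
have := @cexp_q_cvg0 R (1 - s) (- w).
rewrite subr_gt0 => /(_ s1); under eq_cvg => tau.
  rewrite (_ : - w + _ = twopii * tau - (w + twopii * tau * (s%:C)%C)); first over.
  by rewrite (rmorphB (real_complex R)) (rmorph1 (real_complex R)) /=; ring.
by [].
Qed.

(* vartheta(qx) = - q^(-1/2) x^(-1) vartheta(x) *)
Lemma theta_shift tau l : `|cexp (twopii * tau)| <= 2^-1 ->
  theta tau (l + twopii * tau) =
  - cexp (- (l + twopii * tau / 2)) * theta tau l.
Proof.
move=> hq; rewrite !theta_prodE /theta_prod /=.
move: hq; set T := twopii * tau; set q := cexp T => hq.
have -> : cexp (l + T) = q * cexp l by rewrite cexpD mulrC.
have -> : q / (q * cexp l) = (cexp l)^-1 by rewrite invfM mulVKf ?cexp_neq0.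
(* Peeling one factor off phi(qx) and one off phi(1/x) leaves phi(q^2 x) and phi(q/x) on both
   sides. *)
rewrite (phiS (q * cexp l))// (phiS (cexp l)^-1)//.
have -> : - ((l + T) / 2) = - (l + T / 2) + l / 2 by field.
have -> : - (l / 2) = - l + l / 2 by field.
rewrite !(cexpD _ (l / 2)) (cexpN l); have := cexp_neq0 l.
by move: (phi _ _) (phi _ _) => a b; move: (cexp l) => x x0; field.
Qed.

(** In the quotient the shift factors coming from l and q cancel, leaving x^(-1) per shift; negative
    [m] reads the same step backwards. *)
Lemma theta_ratio_shift tau x l (m : int) : `|cexp (twopii * tau)| <= 2^-1 ->
  theta tau (x + (l + twopii * tau * m%:~R)) /
    theta tau (l + twopii * tau * m%:~R) =
  cexp x ^ (- m) * (theta tau (x + l) / theta tau l).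
Proof.
move=> hq; set T := twopii * tau.
have step y : theta tau (x + (y + T)) / theta tau (y + T) =
    (cexp x)^-1 * (theta tau (x + y) / theta tau y).
  rewrite addrA !theta_shift// -/T.
  have -> : - (x + y + T / 2) = - x - (y + T / 2) by ring.
  rewrite cexpD cexpN (invfM (- _)); move: (cexp_neq0 (- (y + T / 2))) (cexp_neq0 x).
  (* The inverse of [theta tau y] stays opaque, so a zero of theta falls under the convention 0^-1 =
     0. *)
  move: (cexp _) (cexp _) (theta tau y)^-1 => e X b e0 X0.
  by field; rewrite e0 X0.
elim/int_ind: m => [|m IH|m IH].
- by rewrite mulr0 addr0 oppr0 expr0z mul1r.
- rewrite -[in LHS]addn1 PoszD rmorphD/= mulrDr mulr1 (addrA l) step IH.
  rewrite mulrA -exprN1 -expfzDr ?cexp_neq0//.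
  by rewrite -[in RHS]addn1 PoszD opprD [X in _ ^ X]addrC.
- have := step (l + T * (- (m.+1)%:Z)%:~R).
  have -> : l + T * (- (m.+1)%:Z)%:~R + T = l + T * (- m%:Z)%:~R.
    by rewrite -addn1 PoszD opprD rmorphD/=; ring.
  move=> E; apply: (mulfI (invr_neq0 (cexp_neq0 x))); rewrite -E IH.
  rewrite [RHS]mulrA -[X in _ = X * _ * _]exprN1 -expfzDr ?cexp_neq0// !opprK.
  by rewrite -[in RHS]addn1 PoszD addrCA subrr addr0.
Qed.

Lemma theta_ratioE tau x l :
  theta tau (x + l) / theta tau l =
  cexp (- (x / 2)) * (theta_prod tau (x + l) / theta_prod tau l).
Proof.
rewrite !theta_prodE.
have -> : - ((x + l) / 2) = - (x / 2) - l / 2 by ring.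
rewrite cexpD (invfM (- _)); move: (cexp_neq0 (- (l / 2))).
move: (cexp _) (cexp _) (theta_prod _ _) (theta_prod _ _)^-1 => e X a b X0.
by field.
Qed.

Lemma theta_ratio_cvg x w (s : R) : s != (Num.floor s)%:~R ->
  theta tau (x + (w + twopii * tau * (s%:C)%C)) /
    theta tau (w + twopii * tau * (s%:C)%C) @[tau --> q_to_0] -->
  (cexp (- (x / 2)) * cexp x ^ (- Num.floor s) : C^o).
Proof.
set m := Num.floor s => sm; pose r := s - m%:~R.
have r01 : 0 < r < 1.
  rewrite subr_gt0 lt_neqAle eq_sym sm floor_le /= /r ltrBlDl.
  by have := floorD1_gt s; rewrite rmorphD.
have sE : (s%:C)%C = (r%:C)%C + m%:~R :> C.
  by rewrite /r (rmorphB (real_complex R)) (rmorph_int (real_complex R)) subrK.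
have E tau : w + twopii * tau * (s%:C)%C =
    w + twopii * tau * (r%:C)%C + twopii * tau * m%:~R by rewrite sE; ring.
have <- : cexp x ^ (- m) * (cexp (- (x / 2)) * (1 * 1^-1)) =
  cexp (- (x / 2)) * cexp x ^ (- m) by rewrite invr1 !mulr1 mulrC.
suff : cexp x ^ (- m) * (cexp (- (x / 2)) *
    (theta_prod tau (x + w + twopii * tau * (r%:C)%C) *
     (theta_prod tau (w + twopii * tau * (r%:C)%C))^-1))
    @[tau --> q_to_0] -->
    (cexp x ^ (- m) * (cexp (- (x / 2)) * (1 * 1^-1)) : C^o).
  (* The shift formula asks for |q| <= 1/2, so the two functions agree only eventually. *)
  apply: cvg_trans; apply: near_eq_cvg; near=> tau.
  have hq : `|cexp (twopii * tau)| <= 2^-1 by near: tau; exact: nome_small.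
  by rewrite E (theta_ratio_shift _ _ _ hq) theta_ratioE (addrA x w).
apply: cvgC_mul; first exact: cvgC_cst.
apply: cvgC_mul; first exact: cvgC_cst.
apply: cvgC_mul; first exact: theta_prod_cvg1.
by apply: cvgC_inv; [exact: oner_neq0|exact: theta_prod_cvg1].
Unshelve. all: by end_near. Qed.

End Theta.

(** * Alcoves, symmetrization and counting *)

Section AlcoveFloor.
Context {R : realType} {N : nat}.

(** The coordinate difference is continuous and avoids the integers on a connected set, so its floor
    is constant there, whichever point [get] picks. *)
Lemma alcove_floor (D : set 'rV[R]_N) (nu : 'rV[R]_N) (i j : 'I_N) :
  is_alcove D -> D nu -> (i < j)%N ->
  alcove_char D i j = Num.floor (nu 0 j - nu 0 i).
Proof.
case=> x Hx ->; set D' := connected_component _ _ => Dnu ij.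
rewrite /alcove_char; set nu' := get D'; have Dnu' : D' nu' by exact: getI Dnu.
pose f (y : 'rV[R]_N) : R := y 0 j - y 0 i.
have coord k : continuous (fun y : 'rV[R]_N => y 0 k) by exact: coord_continuous.
have cf : continuous f by move=> y; apply: (cvgB (coord j y)); exact: coord.
have : connected (f @` D').
  apply: connected_continuous_connected; first exact: component_connected.
  exact: continuous_subspaceT.
move=> /connected_intervalP itvf.
have not_int y (m : int) : D' y -> f y != m%:~R.
  by move=> /connected_component_sub; apply.
have le_floor a b : D' a -> D' b -> Num.floor (f b) <= Num.floor (f a).
  move=> Da Db; rewrite leNgt; apply/negP => lt_ab.
  (* The integer floor (f b) lies between f a and f b, so the interval property would make it a
     value of f. *)
  have [|y Dy fy] := itvf (f a) (f b) (ex_intro2 _ _ a Da erefl)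
    (ex_intro2 _ _ b Db erefl) (Num.floor (f b))%:~R.
    by rewrite floor_le andbT ltW// -floor_lt_int.
  by have /eqP := not_int y (Num.floor (f b)) Dy.
by apply/eqP; rewrite eq_le !le_floor.
Qed.

End AlcoveFloor.

(** * Passing limits and common factors through the symmetrization *)

Section Symmetrization.
Context {N : nat} {lam : N.-tuple nat}.

Lemma dfwith_map (T U : Type) (g : T -> U) (t : vars lam T) (k : nat)
    (s : 'S_(psum lam k)) :
  (fun i a => g (dfwith t k (t k \o s) i a)) =
  dfwith (fun i a => g (t i a)) k ((fun a => g (t k a)) \o s) :> vars lam U.
Proof.
apply: functional_extensionality_dep => i.
have [->|ki] := eqVneq i k; first by rewrite !dfwithin.
by rewrite !dfwithout// eq_sym.
Qed.

(** [Sym] evaluates its argument at permuted variables, so a hypothesis on t is available there only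
    if permutations preserve it. *)
Definition perm_invariant (T : Type) (P : vars lam T -> Prop) : Prop :=
  forall t (k : nat) (s : 'S_(psum lam k)), P t -> P (dfwith t k (t k \o s)).

Lemma Sym_cvg (R : realType) (S T : Type) (F : set_system S) (FF : Filter F)
    (P : vars lam T -> Prop) (f : S -> vars lam T -> R[i])
    (g : vars lam T -> R[i]) :
  perm_invariant P ->
  (forall t, P t -> f x t @[x --> F] --> (g t : R[i]^o)) ->
  forall t, P t -> Defs.Sym (f x) t @[x --> F] --> (Defs.Sym g t : R[i]^o).
Proof.
move=> Pinv fg; rewrite /Defs.Sym; elim: (iota 1 N.-1) => [//|k r IH] t Pt /=.
by apply: cvgC_sum => s _; apply: IH; exact: Pinv.
Qed.

(** Links a symmetrization over logarithms to one over the variables: permuting commutes with [g],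
    and [c] leaves the sums. *)
Lemma Sym_map_scale (R : pzRingType) (T U : Type) (g : T -> U)
    (P : vars lam T -> Prop) (f : vars lam T -> R) (h : vars lam U -> R) (c : R) :
  perm_invariant P ->
  (forall t, P t -> f t = c * h (fun k a => g (t k a))) ->
  forall t, P t -> Defs.Sym f t = c * Defs.Sym h (fun k a => g (t k a)).
Proof.
move=> Pinv fh; rewrite /Defs.Sym; elim: (iota 1 N.-1) => [//|k r IH] t Pt /=.
rewrite /SymAt mulr_sumr; apply: eq_bigr => s _.
by rewrite IH ?dfwith_map//; exact: Pinv.
Qed.

Lemma perm_invariantI (T : Type) (P Q : vars lam T -> Prop) :
  perm_invariant P -> perm_invariant Q -> perm_invariant (fun t => P t /\ Q t).
Proof. by move=> hP hQ t k s [Pt Qt]; split; [exact: hP|exact: hQ]. Qed.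

Lemma distinct_perm_invariant (T : Type) (U : eqType) (g : T -> U) :
  perm_invariant (fun t => forall (k : nat) (a b : 'I_(psum lam k)),
    (k < N)%N -> a != b -> g (t k a) != g (t k b)).
Proof.
move=> t k s ht i a b; have [ki|ki] := eqVneq k i; last first.
  by rewrite !dfwithout//; exact: ht.
by case: _ / ki a b => a b kN ab; rewrite !dfwithin /= ht// (inj_eq perm_inj).
Qed.

(** Each level enters only through the sum of its variables, which makes the symmetry visible. *)
Lemma logXE (R : realType) (t : vars lam R[i]) :
  logX t = \sum_(k < N | (0 < k)%N)
    ((\sum_b t k.+1 b) *+ psum lam k - (\sum_a t k a) *+ psum lam k.+1).
Proof.
apply: eq_bigr => k _; under eq_bigr do rewrite sumrB sumr_const card_ord.
by rewrite sumrB sumr_const card_ord sumrMnl.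
Qed.

Lemma logX_perm_invariant (R : realType) (L : R[i]) :
  perm_invariant (fun t : vars lam R[i] => logX t = L).
Proof.
move=> t k s <-; rewrite !logXE.
have sumE i : \sum_a dfwith t k (t k \o s) i a = \sum_a t i a.
  have [->|ki] := eqVneq i k; last by rewrite dfwithout// eq_sym.
  by rewrite dfwithin [RHS](reindex_inj (@perm_inj _ s)).
by apply: eq_bigr => i _; rewrite !sumE.
Qed.

End Symmetrization.

(** * Counting inversions of an ordered partition *)

Section Counting.
Local Open Scope nat_scope.
Context {n N : nat} {lam : N.-tuple nat}.
Implicit Type I : opart n lam.

Lemma block_ofP I (m : 'I_n) : m \in I (block_of I m).
Proof. exact: (xchooseP (opart_cover I m)). Qed.

Lemma in_block I (k : 'I_N) (m : 'I_n) : (m \in I k) = (block_of I m == k).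
Proof.
apply/idP/eqP => [mk|<-]; last exact: block_ofP.
apply/eqP/negPn/negP => /(opart_disjoint I); rewrite disjoint_subset.
by move=> /fintype.subsetP/(_ m (block_ofP I m)); rewrite inE mk.
Qed.

Lemma in_union_blocks I k (m : 'I_n) :
  (m \in union_blocks I k) = (block_of I m < k).
Proof.
apply/bigcupP/idP => [[j jk]|mk]; first by rewrite in_block => /eqP ->.
by exists (block_of I m) => //; exact: block_ofP.
Qed.

Lemma sum_elt I k (f : 'I_n -> nat) :
  \sum_(a < psum lam k) f (elt I a) = \sum_(x in union_blocks I k) f x.
Proof.
rewrite [RHS]big_enum_val [RHS](reindex (cast_ord (card_union_blocks I k)))//=.
by exists (cast_ord (esym (card_union_blocks I k))) => ? _;
  rewrite ?cast_ordK ?cast_ordKV.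
Qed.

Lemma elt_in I k (a : 'I_(psum lam k)) : elt I a \in union_blocks I k.
Proof. exact: enum_valP. Qed.

(** Trichotomy on A x A: two strict parts of equal size and the diagonal. *)
Lemma double_sum_ltn m (A : {set 'I_m}) :
  (\sum_(x in A) \sum_(y in A) (y < x)).*2 + #|A| = #|A| ^ 2.
Proof.
have -> : #|A| = \sum_(x in A) \sum_(y in A) (x == y).
  rewrite -sum1_card; apply: eq_bigr => x xA.
  by rewrite (bigD1 x)//= eqxx big1// => y /andP[_ /negPf]; rewrite eq_sym => ->.
rewrite -addnn {2}exchange_big /= -!big_split/=.
have -> : \sum_(x in A) \sum_(y in A) (x == y) = #|A|.
  rewrite -sum1_card; apply: eq_bigr => x xA.
  by rewrite (bigD1 x)//= eqxx big1// => y /andP[_ /negPf]; rewrite eq_sym => ->.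
rewrite -mulnn -[in RHS]sum_nat_const; apply: eq_bigr => x xA.
rewrite -!big_split -sum1_card; apply: eq_bigr => y yA /=.
by rewrite -(inj_eq val_inj) /=; case: ltngtP.
Qed.

(** Inversions are sorted by the block k of their smaller entry y; the larger entry x then lies in a
    block of index below k. *)
Lemma ellIE I : ellI I =
  \sum_(k < N | 0 < k) \sum_(x in union_blocks I k) \sum_(y in I k) (y < x).
Proof.
pose b (x : 'I_n) := block_of I x.
transitivity (\sum_(x < n) \sum_(y < n) ((y < x) && (b x < b y))).
  rewrite /ellI -sum1_card pair_bigA /= big_mkcond /=.
  apply: eq_bigr => -[x y] _ /=; rewrite inE /=.
  suff -> : [exists j, exists k, [&& x \in I j, y \in I k & j < k]] = (b x < b y).
    by case: (_ && _).
  apply/existsP/idP => [[j /existsP[k]]|xy].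
    by rewrite !in_block => /and3P[/eqP <- /eqP <-].
  by exists (b x); apply/existsP; exists (b y); rewrite !block_ofP.
transitivity (\sum_(k < N) \sum_(x < n) \sum_(y < n)
    [&& y < x, b x < k & b y == k]).
  rewrite [RHS]exchange_big; apply: eq_bigr => x _; rewrite [RHS]exchange_big.
  apply: eq_bigr => y _ /=; rewrite [RHS](bigD1 (b y))//= eqxx andbT big1 ?addn0//.
  by move=> k /negPf; rewrite eq_sym => ->; rewrite !andbF.
rewrite [RHS]big_mkcond /=; apply: eq_bigr => k _.
case: posnP => [->|k0].
  by rewrite big1// => x _; rewrite big1// => y _; rewrite andbF.
rewrite [RHS]big_mkcond /=; apply: eq_bigr => x _.
rewrite in_union_blocks -/(b x); case: ltnP => _; last first.
  by rewrite big1// => y _; rewrite andbF.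
rewrite [RHS]big_mkcond /=; apply: eq_bigr => y _.
by rewrite in_block -/(b y); case: (b y == k); rewrite ?andbT ?andbF.
Qed.

End Counting.

(** * Exponents of the sign, of h and of the variables in X *)

Section Exponents.
Local Open Scope nat_scope.
Context {n N : nat} {lam : N.-tuple nat}.
Implicit Type I : opart n lam.

(** The default 0 of [nth] makes this hold past the last block too. *)
Lemma psumS k : psum lam k.+1 = psum lam k + nth 0 lam k.
Proof.
rewrite /psum; have [Nk|kN] := leqP N k.
  rewrite nth_default ?size_tuple// addn0; apply: eq_bigl => j.
  by rewrite ltnS (leq_trans (ltnW (ltn_ord j)) Nk) (leq_trans (ltn_ord j) Nk).
rewrite (bigD1 (Ordinal kN))//= (tnth_nth 0) addnC; congr (_ + _).
by apply: eq_bigl => j; rewrite -(inj_eq val_inj) /= ltnS andbC -ltn_neqAle.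
Qed.

Lemma psum_full : psum lam N = \sum_(k < N) tnth lam k.
Proof. by apply: eq_bigl => j; rewrite ltn_ord. Qed.

Lemma sum_union_blocksS I (k : 'I_N) (f : 'I_n -> nat) :
  \sum_(x in union_blocks I k.+1) f x =
  \sum_(x in union_blocks I k) f x + \sum_(x in I k) f x.
Proof.
rewrite !(big_mkcond (fun x => x \in _)) -big_split /=.
apply: eq_bigr => x _; rewrite !in_union_blocks in_block ltnS.
rewrite -(inj_eq val_inj) /=; case: ltngtP => //= _; by rewrite ?addn0.
Qed.

Lemma sum_ltn_ord m : (\sum_(a < m) \sum_(b < m | a < b) 1).*2 + m = m ^ 2.
Proof.
rewrite -[X in _ + X = _]card_ord -[in RHS](card_ord m) -!cardsT -double_sum_ltn.
congr (_.*2 + _); rewrite exchange_big /=.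
rewrite [RHS](eq_bigl predT) => [|a]; last by rewrite inE.
apply: eq_bigr => a _; rewrite big_mkcond [RHS]big_mkcond.
by apply: eq_bigr => b _; rewrite inE.
Qed.

(** With m the size of level k, the pairs inside level k are counted once by the psi factors and
    once by the kernels, m(m-1)/2 each; adding m gives m^2. What remains has y in the block added at
    level k+1. *)
Lemma sum_inversions I (k : 'I_N) :
  psum lam k + \sum_(a < psum lam k) (\sum_(c < psum lam k.+1) (elt I c < elt I a) +
    \sum_(b < psum lam k | a < b) 1) =
  psum lam k ^ 2 + \sum_(x in union_blocks I k) \sum_(y in I k) (y < x).
Proof.
rewrite big_split /=.
under eq_bigr => a _ do rewrite
  (sum_elt I k.+1 (fun y => nat_of_bool (y < elt I a))).
rewrite (sum_elt I k (fun x => \sum_(y in union_blocks I k.+1) (y < x))).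
under eq_bigr do rewrite sum_union_blocksS.
rewrite big_split /= -(sum_ltn_ord (psum lam k)).
have := double_sum_ltn (union_blocks I k); rewrite -card_union_blocks.
have := sum_ltn_ord (psum lam k).
move: (\sum_(x in _) \sum_(y in union_blocks I k) _) => u.
move: (\sum_(x in _) \sum_(y in I k) _) => v.
move: (\sum_(a < _) \sum_(b < _ | _) _) => w; lia.
Qed.

Lemma sum_neq_elt I (k : 'I_N) (a : 'I_(psum lam k)) :
  (\sum_(c < psum lam k.+1) (elt I c != elt I a)).+1 = psum lam k.+1.
Proof.
rewrite (sum_elt I k.+1 (fun y => nat_of_bool (y != elt I a))).
rewrite (card_union_blocks I) -[in RHS]sum1_card [RHS](bigD1 (elt I a)) /=; last first.
  by have := elt_in I a; rewrite !in_union_blocks ltnS => /ltnW.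
rewrite add1n; congr _.+1; rewrite big_mkcondr /=.
by apply: eq_bigr => y _; case: eqP.
Qed.

(** Each a lacks a sign at exactly one c, the one with the same element; the power of theta(h), with
    one sign per a, fills the gap. *)
Lemma sign_exponent I :
  lambda_one lam + \sum_(k < N | 0 < k) \sum_(a < psum lam k)
    \sum_(c < psum lam k.+1) (elt I c != elt I a) =
  \sum_(k < N | 0 < k) psum lam k * psum lam k.+1.
Proof.
rewrite /lambda_one -big_split; apply: eq_bigr => k _ /=.
rewrite -[X in X + _]muln1 -{1}[psum lam k]card_ord -sum_nat_const -big_split /=.
under eq_bigr do rewrite add1n sum_neq_elt.
by rewrite sum_nat_const card_ord.
Qed.

Lemma h_exponent I :
  lambda_one lam + \sum_(k < N | 0 < k) \sum_(a < psum lam k)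
    (\sum_(c < psum lam k.+1) (elt I c < elt I a) +
     \sum_(b < psum lam k | a < b) 1) =
  \sum_(k < N | 0 < k) psum lam k ^ 2 + ellI I.
Proof.
rewrite ellIE /lambda_one -!big_split; apply: eq_bigr => k _ /=.
exact: sum_inversions.
Qed.

(** [T k] stands for the product of the variables of level k: it gets exponent [psum lam k.-1] from
    one factor and minus [psum lam k.+1] from the next, and only the top level lacks the latter. *)
Lemma prod_telescope (K : fieldType) (T : nat -> K) M :
  (forall k, T k != 0)%R -> 0 < M ->
  (\prod_(k < M | (0 < k)%N) (T k.+1 ^+ psum lam k / T k ^+ psum lam k.+1) =
  (\prod_(k < M | (0 < k)%N) T k ^- (nth 0%N lam k.-1 + nth 0%N lam k)) *
    T M ^+ psum lam M.-1)%R.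
Proof.
move=> T0; rewrite big_mkcond [in RHS]big_mkcond /=; elim: M => [//|[_ _|M IH _]].
  have p0 : psum lam 0 = 0 by rewrite /psum big_pred0.
  by rewrite !big_ord_recr !big_ord0 /= p0 expr0 !mulr1.
rewrite big_ord_recr [in RHS]big_ord_recr /= IH//= -!mulrA; congr (_ * _)%R.
rewrite (psumS M.+1) (psumS M) -addnA mulrCA [RHS]mulrC; congr (_ * _)%R.
by rewrite [in LHS]exprD invfM mulVKf ?expf_neq0.
Qed.

End Exponents.

(** * The limit of the weight function *)

Section Limit.
Context {R : realType} {n N : nat} {lam : N.-tuple nat}.
Local Notation C := R[i].
Implicit Type (I : opart n lam) (lt : vars lam C).

(* The monomial by which the limit of psi_ell differs from psi_trig; the
   case elt I c = elt I a is the only one without a sign. *)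
Definition psi_factor I (lh : C) (k : nat) (a : 'I_(psum lam k))
    (c : 'I_(psum lam k.+1)) (lx : C) : C :=
  (-1) ^+ (elt I c != elt I a) * cexp (- (lh / 2)) ^+ (elt I c < elt I a)%N *
  cexp (- (lx / 2)).

Lemma psi_cvg I (D : set 'rV[R]_N) (nu : 'rV[R]_N) (lh lx : C) (k : 'I_N)
    (a : 'I_(psum lam k)) (c : 'I_(psum lam k.+1)) :
  is_alcove D -> D nu ->
  psi_ell I tau lh (fun j => twopii * tau * ((nu 0 j)%:C)%C) a c lx
    @[tau --> q_to_0] -->
  (psi_factor I lh a c lx * psi_trig I D (cexp lh) a c (cexp lx) : C^o).
Proof.
move=> HD Dnu; rewrite /psi_ell /psi_factor /psi_trig -(inj_eq val_inj) /=.
case: ltngtP => _ /=.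
- rewrite !expr1 mulN1r.
  have <- : - cexp (- ((lh + lx) / 2)) * (1 - cexp (lh + lx)) =
      - cexp (- (lh / 2)) * cexp (- (lx / 2)) * (1 - cexp lh * cexp lx).
    have -> : - ((lh + lx) / 2) = - (lh / 2) - lx / 2 by ring.
    by rewrite !cexpD !mulNr.
  exact: theta_cvg.
- rewrite expr1 expr0 mulr1 mulN1r; exact: theta_cvg.
rewrite !expr0 !mul1r; set j := block_of I _.
(* An element of level k lies in a block below k, so the characteristic is taken at an ordered
   pair. *)
have jk : (j < k)%N by rewrite -in_union_blocks elt_in.
rewrite (alcove_floor HD Dnu jk); set s := nu 0 k - nu 0 j.
have /theta_ratio_cvg : s != (Num.floor s)%:~R.
  by case: HD Dnu => x _ -> /connected_component_sub; apply.
(* The power of h in the argument is a fixed shift [w], which does not affect the limit. *)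
move=> /(_ lx ((1 + (pI I j (elt I a))%:R - (pI I k (elt I a))%:R) * lh)).
apply: cvg_trans; apply: near_eq_cvg; apply: nearW => tau.
have -> : (s%:C)%C = ((nu 0 k)%:C)%C - ((nu 0 j)%:C)%C :> C.
  by rewrite (rmorphB (real_complex R)).
by rewrite mulrBr (addrA (_ * lh)).
Qed.

Lemma kernel_cvg (lh la lb : C) : cexp la != cexp lb ->
  theta tau (lh + lb - la) / theta tau (lb - la) @[tau --> q_to_0] -->
  (cexp (- (lh / 2)) * ((1 - cexp lh * (cexp lb / cexp la)) /
     (1 - cexp lb / cexp la)) : C^o).
Proof.
(* Distinct variables keep the limit of the denominator nonzero, so inversion is continuous
   there. *)
move=> ab; have d0 : 1 - cexp lb / cexp la != 0.
  by rewrite subr_eq0; apply: contra_neq ab => /esym/divr1_eq.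
have -> : cexp (- (lh / 2)) * ((1 - cexp lh * (cexp lb / cexp la)) /
     (1 - cexp lb / cexp la)) =
   (- cexp (- ((lh + lb - la) / 2)) * (1 - cexp (lh + lb - la))) *
   (- cexp (- ((lb - la) / 2)) * (1 - cexp (lb - la)))^-1.
  have -> : - ((lh + lb - la) / 2) = - (lh / 2) - (lb - la) / 2 by ring.
  rewrite -addrA (cexpD (- (lh / 2))) (cexpD lh) (cexpB lb).
  move: d0 (cexp_neq0 (- ((lb - la) / 2))).
  move: (cexp (- (_ / _))) (cexp lb / cexp la) (cexp (- (lh / 2))) (cexp lh).
  by move=> u r v h r0 u0; field; rewrite r0 u0.
apply: cvgC_mul; first exact: theta_cvg.
apply: cvgC_inv; last exact: theta_cvg.
by rewrite mulf_neq0 ?oppr_eq0 ?cexp_neq0// cexpB.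
Qed.

(** Signs, powers of h^(-1/2) and half-logarithms are collected separately; the counting identities
    evaluate the first two, and the third is [logX] by definition. *)
Lemma prefactorE I (lh : C) lt :
  (- cexp (- (lh / 2))) ^+ lambda_one lam *
  \prod_(k < N | (0 < k)%N) \prod_(a < psum lam k)
    ((\prod_(c < psum lam k.+1) psi_factor I lh a c (lt k.+1 c - lt k a)) *
     \prod_(b < psum lam k | (a < b)%N) cexp (- (lh / 2))) =
  c_coef lam lh * cexp (- ((ellI I)%:R / 2) * lh) * cexp (- (logX lt / 2)).
Proof.
have halfM m : cexp (- (m%:R / 2) * lh) = cexp (- (lh / 2)) ^+ m :> C.
  by rewrite -cexpMnl; congr cexp; ring.
rewrite /c_coef !halfM; set E := cexp (- (lh / 2)).
have key (a b c d e : C) : a * b * (c * d * e) = a * c * (b * d) * e by ring.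
have inner (k : 'I_N) (a : 'I_(psum lam k)) :
    (\prod_(c < psum lam k.+1) psi_factor I lh a c (lt k.+1 c - lt k a)) *
      \prod_(b < psum lam k | (a < b)%N) E =
    (-1) ^+ (\sum_(c < psum lam k.+1) (elt I c != elt I a))%N *
    E ^+ (\sum_(c < psum lam k.+1) (elt I c < elt I a) +
          \sum_(b < psum lam k | a < b) 1)%N *
    cexp (- ((\sum_(c < psum lam k.+1) (lt k.+1 c - lt k a)) / 2)).
  rewrite exprD !expr_sum big_split /= big_split /= mulr_suml -sumrN cexp_sum.
  by rewrite -!mulrA; congr (_ * (_ * _)); rewrite mulrC.
under eq_bigr do (under eq_bigr do rewrite inner; rewrite 2!big_split /=).
rewrite 2!big_split /=.
under [X in _ * (_ * _ * X)]eq_bigr do rewrite -cexp_sum sumrN -mulr_suml.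
rewrite -cexp_sum sumrN -mulr_suml -/(logX lt).
under [X in _ * (X * _ * _)]eq_bigr do rewrite -expr_sum.
under [X in _ * (_ * X * _)]eq_bigr do rewrite -expr_sum.
rewrite -!expr_sum -(sign_exponent I) -(mulrA _ (E ^+ _) (E ^+ _)) -(exprD E).
rewrite -(h_exponent I) exprD (exprD E) (exprNn E).
by rewrite key.
Qed.

Lemma integrand_cvg I (D : set 'rV[R]_N) (nu : 'rV[R]_N) (lh : C) lt :
  is_alcove D -> D nu ->
  (forall (k : nat) (a b : 'I_(psum lam k)),
    (k < N)%N -> a != b -> cexp (lt k a) != cexp (lt k b)) ->
  \prod_(k < N | (0 < k)%N) \prod_(a < psum lam k)
    ((\prod_(c < psum lam k.+1)
        psi_ell I tau lh (fun j => twopii * tau * ((nu 0 j)%:C)%C)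
          a c (lt k.+1 c - lt k a)) *
     \prod_(b < psum lam k | (a < b)%N)
        (theta tau (lh + lt k b - lt k a) / theta tau (lt k b - lt k a)))
    @[tau --> q_to_0] -->
  (\prod_(k < N | (0 < k)%N) \prod_(a < psum lam k)
    ((\prod_(c < psum lam k.+1) psi_factor I lh a c (lt k.+1 c - lt k a)) *
     \prod_(b < psum lam k | (a < b)%N) cexp (- (lh / 2))) *
   \prod_(k < N | (0 < k)%N) \prod_(a < psum lam k)
    ((\prod_(c < psum lam k.+1)
        psi_trig I D (cexp lh) a c (cexp (lt k.+1 c) / cexp (lt k a))) *
     \prod_(b < psum lam k | (a < b)%N)
        ((1 - cexp lh * (cexp (lt k b) / cexp (lt k a))) /
         (1 - cexp (lt k b) / cexp (lt k a)))) : C^o).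
Proof.
move=> HD Dnu lt_distinct; rewrite -big_split; apply: cvgC_prod => k _ /=.
rewrite -big_split; apply: cvgC_prod => a _ /=.
rewrite mulrACA -!big_split /=; apply: cvgC_mul.
  by apply: cvgC_prod => c _; rewrite -cexpB; exact: psi_cvg.
apply: cvgC_prod => b ab; apply: kernel_cvg; apply: lt_distinct => //.
by apply: contraTneq ab => ->; rewrite ltnn.
Qed.

Lemma XE (t : vars lam C) : (forall k a, t k a != 0) ->
  X t = \prod_(k < N | (0 < k)%N)
    ((\prod_b t k.+1 b) ^+ psum lam k / (\prod_a t k a) ^+ psum lam k.+1).
Proof.
move=> t0; rewrite /X; apply: eq_bigr => k _.
under [LHS]eq_bigr do rewrite big_split /= prodfV prodr_const card_ord.
by rewrite big_split /= prodr_const card_ord prodfV prodrXl.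
Qed.

End Limit.

Theorem theorem3p1 (R : realType) (n N : nat) (lam : N.-tuple nat)
    (n_gt0 : (0 < n)%N) (N_gt0 : (0 < N)%N)
    (sum_lam : (\sum_(k < N) tnth lam k = n)%N)
    (Delta : set 'rV[R]_N) (Delta_alcove : is_alcove Delta)
    (nu : 'rV[R]_N) (nu_in : Delta nu)
    (I : opart n lam)
    (* fixed logarithms of h, z and t *)
    (lh : R[i]) (lz : 'I_n -> R[i]) (lt : vars lam R[i])
    (* t^(N)_a = z_a *)
    (tN_z : forall (a : 'I_(psum lam N)) (b : 'I_n), a = b :> nat -> lt N a = lz b)
    (* the denominators of W_ell and W_trig do not vanish identically in tau *)
    (t_distinct : forall (k : nat) (a b : 'I_(psum lam k)),
        (k < N)%N -> a != b -> cexp (lt k a) != cexp (lt k b)) :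
  let h := cexp lh in
  let z := fun a => cexp (lz a) in
  let t : vars lam R[i] := fun k a => cexp (lt k a) in
  let lmu := fun (tau : R[i]) (j : 'I_N) => twopii * tau * ((nu 0 j)%:C)%C in
  (W_ell I tau lt lh (lmu tau) : R[i]^o) @[tau --> q_to_0] -->
    (c_coef lam lh * cexp (- ((ellI I)%:R / 2) * lh) * cexp (- (logX lt / 2)) *
     W_trig I Delta t h : R[i]^o)
  /\
  X t =
    (\prod_(k < N | (0 < k)%N) \prod_(a < psum lam k)
       t k a ^- (nth 0%N lam k.-1 + nth 0%N lam k)) *
    \prod_(a < n) z a ^+ (n - nth 0%N lam N.-1).
Proof.
move=> h z t lmu; split; last first.
  have t0 k (a : 'I_(psum lam k)) : t k a != 0 by exact: cexp_neq0.
  have psumN : psum lam N = n by rewrite psum_full.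
  rewrite XE// (prod_telescope (T := fun k => \prod_a t k a)) => [|k|//]; last first.
    by apply/prodf_neq0.
  congr (_ * _).
    by apply: eq_bigr => k _; rewrite prodfV prodrXl.
  (* The top level keeps the exponent [psum lam N.-1], which is n minus the last part. *)
  have -> : (n - nth 0%N lam N.-1 = psum lam N.-1)%N.
    have psumP : psum lam N = (psum lam N.-1 + nth 0 lam N.-1)%N.
      by rewrite -psumS prednK.
    by rewrite -psumN psumP addnK.
  rewrite prodrXl (reindex (cast_ord psumN))/=.
    by congr (_ ^+ _); apply: eq_bigr => a _; rewrite /t (tN_z a (cast_ord psumN a)).
  by exists (cast_ord (esym psumN)) => ? _; rewrite ?cast_ordK ?cast_ordKV.
(* Besides distinctness, [P] fixes log X, so every summand of [Sym] carries the same branch of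
   X^(-1/2). *)
pose P (u : vars lam R[i]) := (forall (k : nat) (a b : 'I_(psum lam k)),
    (k < N)%N -> a != b -> cexp (u k a) != cexp (u k b)) /\ logX u = logX lt.
have Pinv : perm_invariant P.
  apply: perm_invariantI; first exact: distinct_perm_invariant.
  exact: logX_perm_invariant.
have Plt : P lt by [].
(* [c] is the monomial in the limit of the power of theta(h); [prefactorE] includes it, so the
   symmetrized integrand contributes only [c^-1 * pre]. *)
pose c := (- cexp (- (lh / 2))) ^+ lambda_one lam.
pose pre := c_coef lam lh * cexp (- ((ellI I)%:R / 2) * lh) * cexp (- (logX lt / 2)).
have c0 : c != 0 by rewrite expf_neq0// oppr_eq0 cexp_neq0.
rewrite /W_trig mulrCA -/pre.
have := @Sym_cvg _ _ R _ _ q_to_0 _ P _ _ Pinv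
  (fun u Pu => @integrand_cvg _ _ _ _ I _ _ lh u Delta_alcove nu_in (proj1 Pu))
  lt Plt.
rewrite (@Sym_map_scale _ _ _ _ _ cexp P _ (fun t : vars lam R[i] =>
    \prod_(k < N | (0 < k)%N) \prod_(a < psum lam k)
      ((\prod_(c < psum lam k.+1) psi_trig I Delta h a c (t k.+1 c / t k a)) *
       \prod_(b < psum lam k | (a < b)%N)
          ((1 - h * (t k b / t k a)) / (1 - t k b / t k a))))
  (c^-1 * pre) Pinv _ lt Plt); last first.
  move=> u [_ uL]; rewrite /pre -uL -prefactorE -/c.
  by rewrite mulKf.
move=> HSym.
have Hth : theta tau lh ^+ lambda_one lam @[tau --> q_to_0] -->
    (c * (1 - h) ^+ lambda_one lam : R[i]^o).
  by rewrite /c -exprMn; apply: cvgC_exp; exact: theta_cvg.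
have limE S : (1 - h) ^+ lambda_one lam * (pre * S) =
    c * (1 - h) ^+ lambda_one lam * (c^-1 * pre * S).
  by rewrite [RHS]mulrACA mulVKf// mulrCA.
by rewrite limE; apply: cvgC_mul; [exact: Hth|exact: HSym].
Qed.
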